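(* Let $M=M_{n_1}(\mathbb{F}_{q^{d_1}})\times\cdots\times M_{n_k}(\mathbb{F}_{q^{d_k}})$ be a finite-dimensional semisimple $\mathbb{F}_q$-algebra, let $\chi=(\chi_1,\ldots,\chi_k)$ be a multiplicative character of $M^\times$ of determinant type, let $B'=\mathbb{F}_{q^{d_1}}^{n_1}\times\cdots\times\mathbb{F}_{q^{d_k}}^{n_k}$, and let $\eta$ be the character of $(B')^\times$ given by $\eta((x_{ij}))=\prod_{i=1}^k\prod_{j=1}^{n_i}\chi_i(x_{ij})$. Then for every $a\in\mathbb{F}_q^\times$, $$\mathrm{Kl}_M(a;\chi)=q^{N}\cdot \mathrm{Kl}_{B'}(a;\eta),\qquad N=\sum_{i=1}^k d_i\binom{n_i}{2}.$$
   Context: $\mathbb{F}_q$ is a finite field and $\psi\colon\mathbb{F}_q\to\mathbb{C}^\times$ is a fixed nontrivial additive character. Every finite-dimensional semisimple $\mathbb{F}_q$-algebra $M$ is isomorphic to a product $M_{n_1}(\mathbb{F}_{q^{d_1}})\times\cdots\times M_{n_k}(\mathbb{F}_{q^{d_k}})$ with $k,n_i,d_i\geq 1$, and is identified with such a product. Reduced norm and reduced trace: for $x=(A_1,\ldots,A_k)\in M$, $\mathrm{Nrd}(x)=\prod_{i=1}^k \mathrm{Norm}_{\mathbb{F}_{q^{d_i}}/\mathbb{F}_q}(\det A_i)\in\mathbb{F}_q$ and $\mathrm{Trd}(x)=\sum_{i=1}^k \mathrm{Tr}_{\mathbb{F}_{q^{d_i}}/\mathbb{F}_q}(\operatorname{Tr}A_i)\in\mathbb{F}_q$.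 A character $\chi\colon M^\times\to\mathbb{C}^\times$ is of determinant type if there are multiplicative characters $\chi_i\colon\mathbb{F}_{q^{d_i}}^\times\to\mathbb{C}^\times$ with $\chi(A_1,\ldots,A_k)=\prod_i\chi_i(\det A_i)$; one writes $\chi=(\chi_1,\ldots,\chi_k)$. For any finite-dimensional semisimple $\mathbb{F}_q$-algebra $M$, any multiplicative character $\chi\colon M^\times\to\mathbb{C}^\times$ and $a\in\mathbb{F}_q^\times$, the Kloosterman sum is $$\mathrm{Kl}_M(a;\chi)=\sum_{x\in M^\times,\ \mathrm{Nrd}(x)=a}\chi(x)\,\psi(\mathrm{Trd}(x)).$$ This applies in particular to the commutative étale algebra $B'$ (a product of $1\times 1$ matrix algebras), whose elements are tuples $(x_{ij})_{1\le i\le k,\,1\le j\le n_i}$ with $x_{ij}\in\mathbb{F}_{q^{d_i}}$ (invertible iff all coordinates are nonzero), with reduced norm $\prod_{i}\mathrm{Norm}_{\mathbb{F}_{q^{d_i}}/\mathbb{F}_q}(x_{i1}\cdots x_{in_i})$ and reduced trace $\sum_{i}\mathrm{Tr}_{\mathbb{F}_{q^{d_i}}/\mathbb{F}_q}(x_{i1}+\cdots+x_{in_i})$. *)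

(* Defs.v *)
From HB Require Import structures.
From mathcomp Require Import all_boot all_order all_fingroup all_algebra all_solvable all_field.
From mathcomp Require Export complex.
From mathcomp Require Export reals.

Set Implicit Arguments.
Unset Strict Implicit.
Unset Printing Implicit Defensive.

Import GRing.Theory.
Local Open Scope ring_scope.

(* A character with values in the ring C is a function on the ambient type of
   which only the restriction to the group D (with unit e and law op) matters.
   On a group these conditions force the values to be units of C. *)
Definition is_character (T : Type) (C : nzRingType) (D : {pred T}) (e : T)
    (op : T -> T -> T) (c : T -> C) : Prop :=
  c e = 1 /\ {in D &, {morph c : x y / op x y >-> x * y}}.

Definition add_character (A : nzRingType) (C : nzRingType) (c : A -> C) : Prop :=
  is_character predT 0 +%R c.

Definition mul_character (A : unitRingType) (C : nzRingType) (c : A -> C) :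
    Prop :=
  is_character (GRing.unit : {pred A}) 1 *%R c.

(* The type [finvect_type L] is L with its finite type structure; it makes every
   finite extension of the finite field F a splitting field over F, hence
   [galNorm] and [galTrace] apply. These are L-valued, with values in the
   one-dimensional subspace 1%AS; we pull them back to F. *)
Section NormTrace.
Variables (F : finFieldType) (L : fieldExtType F).

Definition fieldNorm (x : finvect_type L) : F :=
  odflt 0 [pick c : F | c%:A == galNorm 1%AS {:finvect_type L}%AS x].

Definition fieldTrace (x : finvect_type L) : F :=
  odflt 0 [pick c : F | c%:A == galTrace 1%AS {:finvect_type L}%AS x].

Lemma fieldNormE x :
  (fieldNorm x)%:A = galNorm 1%AS {:finvect_type L}%AS x.
Proof.
rewrite /fieldNorm; case: pickP => [c /eqP //|no_c].
have /vlineP[c xc] : galNorm 1%AS {:finvect_type L}%AS x \in 1%VS.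
  by rewrite mem_galNorm ?memvf ?finField_galois ?sub1v.
by have := no_c c; rewrite xc eqxx.
Qed.

Lemma fieldTraceE x :
  (fieldTrace x)%:A = galTrace 1%AS {:finvect_type L}%AS x.
Proof.
rewrite /fieldTrace; case: pickP => [c /eqP //|no_c].
have /vlineP[c xc] : galTrace 1%AS {:finvect_type L}%AS x \in 1%VS.
  by rewrite mem_galTrace ?memvf ?finField_galois ?sub1v.
by have := no_c c; rewrite xc eqxx.
Qed.

Lemma fieldNormM : {morph fieldNorm : x y / x * y}.
Proof.
move=> x y; apply: (fmorph_inj (in_alg (finvect_type L))).
by rewrite rmorphM /= !fieldNormE galNormM.
Qed.

Lemma fieldNorm1 : fieldNorm 1 = 1.
Proof.
apply: (fmorph_inj (in_alg (finvect_type L))).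
by rewrite rmorph1 /= fieldNormE galNorm1.
Qed.

Lemma fieldTraceD : {morph fieldTrace : x y / x + y}.
Proof.
move=> x y; apply: (fmorph_inj (in_alg (finvect_type L))).
by rewrite rmorphD /= !fieldTraceE raddfD.
Qed.

Lemma fieldTrace0 : fieldTrace 0 = 0.
Proof.
apply: (fmorph_inj (in_alg (finvect_type L))).
by rewrite rmorph0 /= fieldTraceE raddf0.
Qed.

End NormTrace.

Section SemisimpleAlgebra.
Variables (F : finFieldType) (I : finType) (L : I -> fieldExtType F).
Variable (n : I -> nat).

Definition ssalg : finType :=
  {dffun forall i : I, 'M[finvect_type (L i)]_(n i)}.

Definition ss_one : ssalg := [ffun i => 1%:M].

Definition ss_mul (x y : ssalg) : ssalg := [ffun i => x i *m y i].

Definition ss_unit : {pred ssalg} :=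
  [pred x : ssalg | [forall i, x i \in unitmx]].

Definition Nrd (x : ssalg) : F := \prod_i fieldNorm (\det (x i)).

Definition Trd (x : ssalg) : F := \sum_i fieldTrace (\tr (x i)).

Definition ss_character (C : nzRingType) (chi : ssalg -> C) : Prop :=
  is_character ss_unit ss_one ss_mul chi.

(* chi = (chi_1, ..., chi_k) *)
Definition determinant_type (C : comNzRingType)
    (chi_ : forall i, finvect_type (L i) -> C) (chi : ssalg -> C) : Prop :=
  [/\ ss_character chi,
      forall i, mul_character (chi_ i)
    & {in ss_unit, forall x, chi x = \prod_i chi_ i (\det (x i))}].

Definition Kl (C : nzRingType) (psi : F -> C) (chi : ssalg -> C) (a : F) : C :=
  \sum_(x in ss_unit | Nrd x == a) chi x * psi (Trd x).

End SemisimpleAlgebra.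

(* The algebra B' = \prod_i (L i)^(n i), as the product of the 1 x 1 matrix
   algebras over L i indexed by the pairs (i, j) with j < n i. *)
Section EtaleAlgebra.
Variables (F : finFieldType) (I : finType) (L : I -> fieldExtType F).
Variable (n : I -> nat).

Definition etale_alg : finType :=
  @ssalg F {i : I & 'I_(n i)} (fun p => L (tag p)) (fun=> 1%N).

Definition etale_coord (x : etale_alg) (i : I) (j : 'I_(n i)) :
    finvect_type (L i) :=
  x (Tagged (fun i => 'I_(n i)) j) ord0 ord0.

Definition etale_char (C : comNzRingType)
    (chi_ : forall i, finvect_type (L i) -> C) (x : etale_alg) : C :=
  \prod_(i : I) \prod_(j < n i) chi_ i (etale_coord x j).

Lemma etale_unitE (x : etale_alg) :
  (x \in @ss_unit F _ (fun p => L (tag p)) (fun=> 1%N))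
    = [forall i, forall j : 'I_(n i), etale_coord x j != 0].
Proof.
apply/forallP/forallP => [ux i|ux [i j]].
  by apply/forallP=> j; have := ux (Tagged (fun i => 'I_(n i)) j); rewrite unitmxE det_mx11 unitfE.
by rewrite unitmxE det_mx11 unitfE; have /forallP := ux i; apply.
Qed.

Lemma etale_NrdE (x : etale_alg) :
  Nrd x = \prod_(i : I) fieldNorm (\prod_(j < n i) etale_coord x j).
Proof.
under [RHS]eq_bigr => i _ do
  rewrite (big_morph _ (@fieldNormM F (L i)) (@fieldNorm1 F (L i))).
rewrite (sig_big_dep (fun=> true) (fun i _ => true)
  (fun i (j : 'I_(n i)) => fieldNorm (etale_coord x j))).
by apply: eq_bigr => -[i j] _; rewrite det_mx11.
Qed.

Lemma etale_TrdE (x : etale_alg) :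
  Trd x = \sum_(i : I) fieldTrace (\sum_(j < n i) etale_coord x j).
Proof.
under [RHS]eq_bigr => i _ do
  rewrite (big_morph _ (@fieldTraceD F (L i)) (@fieldTrace0 F (L i))).
rewrite (sig_big_dep (fun=> true) (fun i _ => true)
  (fun i (j : 'I_(n i)) => fieldTrace (etale_coord x j))).
by apply: eq_bigr => -[i j] _; rewrite /mxtrace big_ord1.
Qed.

Lemma etale_char_character (C : comNzRingType)
    (chi_ : forall i, finvect_type (L i) -> C) :
  (forall i, mul_character (chi_ i)) ->
  @ss_character F _ (fun p => L (tag p)) (fun=> 1%N) C (etale_char chi_).
Proof.
move=> chiP; split.
  rewrite /etale_char big1 // => i _; rewrite big1 // => j _.
  by rewrite /etale_coord ffunE mxE; case: (chiP i).
move=> x y; rewrite !etale_unitE => /forallP ux /forallP uy.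
rewrite /etale_char -big_split; apply: eq_bigr => i _.
rewrite -big_split; apply: eq_bigr => j _.
have [_ chiM] := chiP i.
rewrite /= -chiM ?unitfE; last 2 first.
- by have /forallP := ux i; apply.
- by have /forallP := uy i; apply.
by rewrite /etale_coord ffunE mxE big_ord1.
Qed.

End EtaleAlgebra.

(* Main.v *)
(* For a nontrivial additive character psi of a finite field E of order q, sort
   the n x n matrices of given determinant by the lower part c of their first
   column. Multiplying on the left by unipotent matrices with top row (1, v)
   shows that each c != 0 contributes 0 to the sum of psi (tr x); the matrices
   with c = 0 are block upper triangular, with q ^ (n - 1) choices for the top
   right block. By induction the sum over the matrices with determinant t is
   q ^ 'C(n, 2) times the sum over the n-tuples with product t. On each summand
   of Kl_M, chi and Nrd only depend on the tuple of determinants, so the result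
   follows by summing the product of these identities over such tuples. *)

Require Import Defs.
From HB Require Import structures.
From mathcomp Require Import all_boot all_order all_fingroup all_algebra all_field.
From mathcomp Require Import complex reals.

Set Implicit Arguments.
Unset Strict Implicit.
Unset Printing Implicit Defensive.

Import GRing.Theory.
Local Open Scope ring_scope.

Lemma add_characterD (A C : nzRingType) (psi : A -> C) :
  add_character psi -> {morph psi : x y / x + y >-> x * y}.
Proof. by move=> [_ psiD] x y; apply: psiD. Qed.

Lemma add_character_sum (A : nzRingType) (C : comNzRingType) (psi : A -> C)
    (J : finType) (f : J -> A) :
  add_character psi -> psi (\sum_j f j) = \prod_j psi (f j).
Proof. by move=> psiP; apply: big_morph; [exact: add_characterD | case: psiP]. Qed.

(** * Matrix sums over one finite field *)

Section GaussSum.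
Variables (E : finFieldType) (C : idomainType) (psi : E -> C).
Hypotheses (psiP : add_character psi) (psi_nontriv : exists x, psi x != 1).

(* Left multiplication by the unipotent matrix with top row (1, v) keeps the
   determinant and the lower-left block c, and multiplies the summand by
   psi (v c), which is not 1 for a suitable v as soon as c != 0. *)
Lemma sum_dlsubmx_eq0 n (f : E -> C) (c : 'cV[E]_n) : c != 0 ->
  \sum_(x : 'M[E]_(1 + n) | dlsubmx x == c) f (\det x) * psi (\tr x) = 0.
Proof.
move=> /cV0Pn[j cj_neq0]; have [b psib] := psi_nontriv.
pose v : 'rV[E]_n := (b / c j 0) *: delta_mx 0 j.
have trvc : \tr (v *m c) = b.
  by rewrite -scalemxAl -rowE mxtraceZ /mxtrace big_ord1 mxE divfK.
pose u (w : 'rV[E]_n) := block_mx (1%:M : 'M_1) w 0 (1%:M : 'M_n).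
have uK w : cancel (mulmx (u w)) (mulmx (u (- w)) : 'M_(1 + n) -> _).
  move=> x; rewrite mulmxA mulmx_block !mul1mx !mul0mx !mulmx1 !addr0 add0r.
  by rewrite mulmx0 addr0 subrr -scalar_mx_block mul1mx.
set S := \sum_(x | _) _; have SE : S = psi b * S.
  rewrite {1}/S (reindex (mulmx (u v))); last first.
    by exists (mulmx (u (- v))) => x _; [exact: uK|have := uK (- v) x; rewrite opprK; exact].
  rewrite /S mulr_sumr; apply: eq_big => [x|x].
    rewrite -[x in LHS]submxK mulmx_block block_mxKdl.
    by rewrite mul0mx add0r mul1mx.
  rewrite -{1}[x]submxK mulmx_block block_mxKdl mul0mx add0r mul1mx => /eqP dlx.
  rewrite det_mulmx det_ublock !det1 !mul1r mulrCA -(add_characterD psiP).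
  congr (_ * psi _); rewrite -{1 2}[x]submxK mulmx_block !mxtrace_block.
  rewrite !mul1mx !mul0mx add0r dlx mxtraceD trvc. by rewrite (addrC _ b) addrA.
(* Now [(1 - psi b) * S = 0] in an integral domain, and [psi b] is not 1. *)
apply/eqP; move/eqP: SE; rewrite -subr_eq0 -{1}[S]mul1r -mulrBl mulf_eq0.
by rewrite subr_eq0 eq_sym (negPf psib).
Qed.

Lemma sum_det_trace_recl n (f : E -> C) :
  \sum_(x : 'M[E]_(1 + n)) f (\det x) * psi (\tr x)
    = (#|E| ^ n)%:R *
      \sum_(b : E) \sum_(y : 'M[E]_n) f (b * \det y) * psi (b + \tr y).
Proof.
rewrite (partition_big dlsubmx predT) //= (bigD1 0) //=.
rewrite [X in _ + X]big1 ?addr0; last by move=> c; apply: sum_dlsubmx_eq0.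
(* The top right row is the outer component: the summand does not depend on it, so it sums out to
   the factor [#|E| ^ n]. *)
pose h (p : (E * 'M[E]_n) * 'rV[E]_n) := block_mx p.1.1%:M p.2 0 p.1.2.
rewrite (reindex h); last first.
  exists (fun x : 'M_(1 + n) => (ulsubmx x 0 0, drsubmx x, ursubmx x)).
    move=> [[b y] w] _; rewrite /h /= block_mxKul block_mxKur block_mxKdr.
    by rewrite mxE eqxx.
  by move=> x /eqP dlx; rewrite /h /= -[RHS]submxK dlx -mx11_scalar.
rewrite (eq_bigl predT) => [|p]; last by rewrite block_mxKdl eqxx.
under eq_bigr => p _ do
  rewrite /h det_ublock det_scalar1 mxtrace_block mxtrace_scalar.
rewrite -(pair_bigA _ (fun (q : E * 'M[E]_n) (_ : 'rV[E]_n) =>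
  f (q.1 * \det q.2) * psi (q.1 + \tr q.2))) /=.
under eq_bigr do rewrite sumr_const card_mx mul1n.
by rewrite pair_bigA mulr_sumr; under [RHS]eq_bigr do rewrite mulr_natl.
Qed.

Lemma sum_row_recl n (g : E -> E -> C) :
  \sum_(v : 'rV[E]_(1 + n)) g (\prod_j v 0 j) (\sum_j v 0 j)
    = \sum_b \sum_(w : 'rV[E]_n) g (b * \prod_j w 0 j) (b + \sum_j w 0 j).
Proof.
pose h (p : E * 'rV[E]_n) := row_mx (p.1%:M : 'M_1) p.2.
rewrite pair_bigA (reindex h); last first.
  exists (fun v : 'rV_(1 + n) => (lsubmx v 0 0, rsubmx v)).
    by move=> [b w] _; rewrite /h row_mxKl row_mxKr mxE eqxx.
  by move=> v _; rewrite /h /= -mx11_scalar hsubmxK.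
apply: eq_bigr => p _; rewrite !big_split_ord !big_ord1 /h /= row_mxEl mxE eqxx.
by congr (g (_ * _) (_ + _)); apply: eq_bigr => j _; rewrite row_mxEr.
Qed.

(** The weight [f] is arbitrary so that the induction hypothesis can be applied to
    [fun s => f (b * s)], which absorbs the corner entry [b]. *)
Lemma sum_det_trace n (f : E -> C) :
  \sum_(x : 'M[E]_n) f (\det x) * psi (\tr x)
    = (#|E| ^ 'C(n, 2))%:R *
      \sum_(v : 'rV[E]_n) f (\prod_j v 0 j) * psi (\sum_j v 0 j).
Proof.
elim: n f => [|n IHn] f.
  rewrite mul1r (big_pred1 0) => [|x]; last by rewrite [x]flatmx0 /= eqxx.
  rewrite (big_pred1 0) => [|x]; last by rewrite [x]thinmx0 /= eqxx.
  by rewrite det_mx00 /mxtrace !big_ord0.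
rewrite (sum_det_trace_recl n) (sum_row_recl n (fun s t => f s * psi t)).
(* Pascal's rule ['C(n.+1, 2) = 'C(n, 2) + n] matches the factor [#|E| ^ n] of the recursion. *)
rewrite binS bin1 expnD mulnC natrM -mulrA; congr (_ * _).
rewrite mulr_sumr; apply: eq_bigr => b _.
under eq_bigr do rewrite (add_characterD psiP) mulrCA mulrC.
under [in RHS]eq_bigr do rewrite (add_characterD psiP) mulrCA mulrC.
rewrite -!mulr_suml mulrA; congr (_ * _).
exact: (IHn (fun s => f (b * s))).
Qed.

Lemma sum_det_trace_fibre n (t : E) :
  \sum_(x : 'M[E]_n | \det x == t) psi (\tr x)
    = (#|E| ^ 'C(n, 2))%:R *
      \sum_(v : 'rV[E]_n | \prod_j v 0 j == t) psi (\sum_j v 0 j).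
Proof.
have ifE (b : bool) (z : C) : (if b then z else 0) = b%:R * z.
  by rewrite mulr_natl mulrb.
rewrite big_mkcond [in RHS]big_mkcond; under eq_bigr do rewrite ifE.
(* The weight is the indicator of [t]. *)
rewrite (sum_det_trace _ (fun s => (s == t)%:R)); congr (_ * _).
by apply: eq_bigr => v _; rewrite ifE.
Qed.

End GaussSum.

(** * Sums of products over dependent families *)

Section DffunSums.
Variables (C : comNzRingType) (I : finType).

(** Each [X i] is embedded in the tagged union of the family, where non-dependent distributivity
    applies; [fprod] leads back to dependent functions. *)
Lemma bigA_distr_dffun (X : I -> finType) (h : forall i, X i -> C) :
  \prod_i \sum_(x : X i) h i x
    = \sum_(f : {dffun forall i, X i}) \prod_i h i (f i).
Proof.
under eq_bigr do rewrite (big_tag (op := +%R) h).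
rewrite bigA_distr_big_dep.
rewrite (reindex (@dffun_of_fprod I X)); last exact/onW_bij/dffun_of_fprod_bij.
pose h' i := [ffun x : X i => h i x].
transitivity (\sum_(t : fprod X) \prod_(i in I) h' i (t i)); last first.
  by apply: eq_bigr => t _; apply: eq_bigr => i _; rewrite !ffunE.
rewrite (@big_fprod C 0 1 *%R +%R I X h'); apply: eq_bigr => g _; apply: eq_bigr => i _.
by rewrite /untag; case: eqP => // p; rewrite ffunE.
Qed.

(** Over a fixed family of images [t], the weight [G] is constant and the fibre is a product of
    fibres, so the sum factors. *)
Lemma sum_dffun_fibre (X T : I -> finType) (p : forall i, X i -> T i)
    (g : forall i, X i -> C) (G : {dffun forall i, T i} -> C) :
  \sum_(x : {dffun forall i, X i})
     G [ffun i => p i (x i)] * \prod_i g i (x i)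
    = \sum_t G t * \prod_i \sum_(x : X i | p i x == t i) g i x.
Proof.
pose P (x : {dffun forall i, X i}) : {dffun forall i, T i} :=
  [ffun i => p i (x i)].
rewrite (partition_big P predT) //=; apply: eq_bigr => t _.
rewrite big_mkcond; under [in RHS]eq_bigr do rewrite big_mkcond.
rewrite bigA_distr_dffun mulr_sumr; apply: eq_bigr => x _.
have [<-|/eqP Pxt] := eqVneq (P x) t.
  by congr (_ * _); apply: eq_bigr => i _; rewrite ffunE eqxx.
(* Off the fibre some coordinate misses [t i], and its factor is the default 0. *)
have /existsP[i pxi] : [exists i, p i (x i) != t i].
  apply: contra_notT Pxt; rewrite negb_exists => /forallP pxt.
  by apply/ffunP => i; rewrite ffunE; apply/eqP/negPn/pxt.
by rewrite (bigD1 i) //= (negPf pxi) mul0r mulr0.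
Qed.

(** Transfers coordinatewise identities to the whole product. [G] need not factor over [I]: the
    condition on the reduced norm couples the coordinates. *)
Lemma eq_sum_dffun_fibre (X Y T : I -> finType)
    (p : forall i, X i -> T i) (q : forall i, Y i -> T i)
    (g : forall i, X i -> C) (h : forall i, Y i -> C) (c : I -> C)
    (G : {dffun forall i, T i} -> C) :
  (forall i t, \sum_(x | p i x == t) g i x
     = c i * \sum_(y | q i y == t) h i y) ->
  \sum_(x : {dffun forall i, X i})
     G [ffun i => p i (x i)] * \prod_i g i (x i)
    = \prod_i c i * \sum_(y : {dffun forall i, Y i})
        G [ffun i => q i (y i)] * \prod_i h i (y i).
Proof.
move=> gh; rewrite (sum_dffun_fibre p g G) (sum_dffun_fibre q h G) mulr_sumr.
apply: eq_bigr => t _.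
rewrite mulrCA -big_split; congr (_ * _); apply: eq_bigr => i _.
exact: gh.
Qed.

End DffunSums.

(** * The trace form and the characters it induces *)

Section FieldTrace.
Variables (F : finFieldType) (L : fieldExtType F).

Lemma fieldTraceZ c (x : finvect_type L) :
  fieldTrace (c *: x) = c * fieldTrace x.
Proof.
apply: (fmorph_inj (in_alg (finvect_type L))).
rewrite rmorphM /= !fieldTraceE /galTrace mulr_sumr.
by apply: eq_bigr => s _; rewrite linearZ mulr_algl.
Qed.

(* Dedekind independence of the automorphisms. *)
Lemma fieldTrace_neq0 : exists x : finvect_type L, fieldTrace x != 0.
Proof.
have [x _] := @gal_independent_contra _ _ {:finvect_type L}%AS
  (mem 'Gal({:finvect_type L} / 1)%g) (fun=> 1) 1%g (group1 _) (oner_neq0 _).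
move=> sum_neq0; exists x; apply: contraNneq sum_neq0 => Tx0.
apply/eqP; have := fieldTraceE x; rewrite Tx0 scale0r /galTrace => Tr0.
by rewrite [RHS]Tr0; apply: eq_bigr => s _; rewrite mul1r.
Qed.

(** A nonzero linear form is onto. Hence composing a nontrivial [psi] with the trace keeps it
    nontrivial. *)
Lemma fieldTrace_surj c : exists x : finvect_type L, fieldTrace x = c.
Proof.
have [x Tx] := fieldTrace_neq0.
by exists ((c / fieldTrace x) *: x); rewrite fieldTraceZ divfK.
Qed.

Lemma add_character_fieldTrace (C : nzRingType) (psi : F -> C) :
  add_character psi -> add_character (fun x : finvect_type L => psi (fieldTrace x)).
Proof.
move=> [psi0 psiD]; split; first by rewrite fieldTrace0.
by move=> x y _ _; rewrite fieldTraceD psiD.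
Qed.

Lemma card_finvect : #|finvect_type L| = (#|F| ^ \dim {:L})%N.
Proof. by rewrite -(card_vspacef (Vector.class (finvect_type L))) card_vspace. Qed.

End FieldTrace.

Lemma mul_character_prod (A : comUnitRingType) (C : comNzRingType) (c : A -> C)
    (J : finType) (f : J -> A) :
  mul_character c -> (forall j, f j \is a GRing.unit) ->
  c (\prod_j f j) = \prod_j c (f j).
Proof.
move=> [c1 cM] fU; elim: (index_enum J) => [|j r IHr]; first by rewrite !big_nil.
by rewrite !big_cons cM ?IHr ?rpred_prod.
Qed.

(** * Kloosterman sums as weighted sums over determinants *)

Section KloostermanByDeterminant.
Variables (F : finFieldType) (C : comNzRingType) (psi : F -> C).
Hypothesis psiP : add_character psi.
Variables (I : finType) (L : I -> fieldExtType F) (n : I -> nat).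
Variable chi_ : forall i, finvect_type (L i) -> C.

(** The factor shared by both Kloosterman sums. The value 0 encodes invertibility and the norm
    condition, so that the sums run over all elements. *)
Definition det_weight (a : F) (t : {dffun forall i, finvect_type (L i)}) : C :=
  if [forall i, t i != 0] && (\prod_i fieldNorm (t i) == a)
  then \prod_i chi_ (t i) else 0.

Lemma Kl_determinant_type (chi : ssalg L n -> C) a :
  determinant_type chi_ chi ->
  Kl psi chi a = \sum_(x : ssalg L n)
    det_weight a [ffun i => \det (x i)]
    * \prod_i psi (fieldTrace (\tr (x i))).
Proof.
move=> [_ _ chiE]; rewrite /Kl big_mkcond; apply: eq_bigr => x _.
have unitE : [forall i, [ffun i => \det (x i)] i != 0] = (x \in @ss_unit F I L n).
  by apply: eq_forallb => i; rewrite ffunE unitmxE unitfE.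
have NrdE : \prod_i fieldNorm ([ffun i => \det (x i)] i) = Nrd x.
  by apply: eq_bigr => i _; rewrite ffunE.
rewrite /det_weight unitE NrdE; case: ifP => [/andP[xU _]|]; last by rewrite mul0r.
rewrite chiE // /Trd add_character_sum //; congr (_ * _).
by apply: eq_bigr => i _; rewrite ffunE.
Qed.

Lemma Kl_etale a : (forall i, mul_character (@chi_ i)) ->
  Kl psi (@etale_char F I L n C chi_) a
    = \sum_(y : {dffun forall i, 'rV[finvect_type (L i)]_(n i)})
        det_weight a [ffun i => \prod_j y i 0 j]
        * \prod_i psi (fieldTrace (\sum_j y i 0 j)).
Proof.
move=> chiP.
(* Grouping the coordinates [(i, j)] into one row per [i] gives both algebras the same index set of
   factors. *)
pose uncurry (y : {dffun forall i, 'rV[finvect_type (L i)]_(n i)}) :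
  etale_alg L n := [ffun p => const_mx (y (tag p) 0 (tagged p))].
have coordE y i (j : 'I_(n i)) : etale_coord (uncurry y) j = y i 0 j.
  by rewrite /etale_coord ffunE mxE.
rewrite /Kl (reindex uncurry) /=; last first.
  exists (fun x : etale_alg L n => [ffun i => \row_j etale_coord x j]) => y _.
    by apply/ffunP => i; rewrite ffunE; apply/rowP => j; rewrite mxE coordE.
  apply/ffunP => -[i j]; rewrite !ffunE /=; apply/matrixP => r s.
  by rewrite !mxE !ord1.
rewrite big_mkcond; apply: eq_bigr => y _.
have unitE : [forall i, [ffun i => \prod_j y i 0 j] i != 0]
    = (uncurry y \in @ss_unit F _ (fun p => L (tag p)) (fun=> 1%N)).
  rewrite etale_unitE; apply: eq_forallb => i; rewrite ffunE.
  apply/prodf_neq0/forallP => yi j; [rewrite coordE; exact: yi|].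
  by rewrite -coordE.
rewrite /det_weight unitE etale_NrdE etale_TrdE.
have -> : \prod_i fieldNorm ([ffun i => \prod_j y i 0 j] i)
    = \prod_i fieldNorm (\prod_(j < n i) etale_coord (uncurry y) j).
  by apply: eq_bigr => i _; rewrite ffunE; under [in RHS]eq_bigr do rewrite coordE.
case: ifP => [/andP[yU _]|]; last by rewrite mul0r.
rewrite add_character_sum //; congr (_ * _); apply: eq_bigr => i _; last first.
  by congr (psi (fieldTrace _)); apply: eq_bigr => j _; rewrite coordE.
rewrite ffunE (mul_character_prod (chiP i)).
  by apply: eq_bigr => j _; rewrite coordE.
move: yU; rewrite etale_unitE => /forallP/(_ i)/forallP yi j.
by rewrite unitfE -coordE.
Qed.

End KloostermanByDeterminant.

Theorem theorem1p6 (R : realType) (F : finFieldType)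
    (psi : F -> R[i]) (psi_char : add_character psi)
    (psi_nontrivial : exists x : F, psi x != 1)
    (k : nat) (k_gt0 : (0 < k)%N)
    (n d : 'I_k -> nat) (n_gt0 : forall i, (0 < n i)%N)
    (L : 'I_k -> fieldExtType F) (dimL : forall i, \dim {:L i} = d i)
    (chi_ : forall i : 'I_k, finvect_type (L i) -> R[i])
    (chi : ssalg L n -> R[i]) (chi_det : determinant_type chi_ chi)
    (a : F) (a_neq0 : a != 0) :
  Kl psi chi a
    = (#|F| ^ (\sum_(i < k) d i * 'C(n i, 2)))%:R
      * Kl psi (@etale_char F 'I_k L n R[i] chi_) a.
Proof.
have [_ chiP _] := chi_det.
rewrite (Kl_determinant_type psi_char a chi_det) (Kl_etale psi_char n a chiP).
(* In each factor the determinant is matched with the product of the entries of a row; [c i] is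
   [#|L i| ^ 'C(n i, 2)] rewritten in terms of [#|F|]. *)
rewrite (eq_sum_dffun_fibre
  (p := fun i (x : 'M[finvect_type (L i)]_(n i)) => \det x)
  (q := fun i (v : 'rV[finvect_type (L i)]_(n i)) => \prod_j v 0 j)
  (g := fun i x => psi (fieldTrace (\tr x)))
  (h := fun i v => psi (fieldTrace (\sum_j v 0 j)))
  (c := fun i => (#|F| ^ (d i * 'C(n i, 2)))%:R)
  (det_weight chi_ a)).
  by rewrite -natr_prod expn_sum.
move=> i t; rewrite (sum_det_trace_fibre (add_character_fieldTrace (L i) psi_char)).
  by rewrite card_finvect dimL expnM.
have [c psic] := psi_nontrivial; have [x trx] := fieldTrace_surj (L i) c.
by exists x; rewrite trx.
Qed.
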